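(* Let $X$ be a Hausdorff topological vector space over $\mathbb{R}$ or $\mathbb{C}$, $A\subset X$ a convex set, $H$ a nonempty set of functions $X\to\overline{\mathbb{R}}$ closed under vertical shifts (i.e. $h+c\in H$ for all $h\in H$, $c\in\mathbb{R}$), and $f_i\colon X\to\mathbb{R}$, $i\in I_0=\{0\}\cup I$, $I=\{1,\ldots,n\}$. Let $\psi_i\colon X\to\overline{\mathbb{R}}$ be weak lower $H$-concave approximations of the functions $f_i$ at a point $x^*\in A$ such that $\psi_i(0)=0$, $i\in I_0$. Suppose that $x^*$ is a point of local maximum in the problem $$f_0(x)\to\sup,\quad x\in A,\quad f_i(x)\ge0,\quad i\in I,$$ and that the $H$-concave function $$g(\cdot)=\inf\{\psi_0(\cdot),\psi_1(\cdot)+f_1(x^* ),\ldots,\psi_n(\cdot)+f_n(x^* )\}$$ is superhomogeneous. Then $0$ is a point of global maximum of $g$ on the set $A-x^*$. Moreover, if $A=X$ and $0\in H$, then $0\in\overline{\partial}_Hg(0)$.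
   Context: $\overline{\mathbb{R}}=\mathbb{R}\cup\{\pm\infty\}$; for $f\colon X\to\overline{\mathbb{R}}$, $\operatorname{dom}f=\{x: f(x)\in\mathbb{R}\}$. A function $X\to\overline{\mathbb{R}}$ is $H$-concave if it is the pointwise infimum of a nonempty subset of $H$. $A-x^*=\{a-x^*\mid a\in A\}$. An $H$-concave function $\psi\colon X\to\overline{\mathbb{R}}$ is a weak lower $H$-concave approximation of $f\colon X\to\mathbb{R}$ at $x$ if (1) $\psi(0)\le0$ and $0\in\operatorname{int}\operatorname{dom}\psi$; (2) for every $\Delta x\in X$ there exist $\alpha_0>0$ and $\beta\colon(0,\alpha_0)\to\mathbb{R}$ such that $\operatorname{co}\{0,\alpha_0\Delta x\}\subset\operatorname{dom}\psi$, $\beta(\alpha)\to0$ as $\alpha\downarrow0$, and $f(x+\alpha\Delta x)-f(x)\ge\psi(\alpha\Delta x)-\alpha\beta(\alpha)$ for all $\alpha\in(0,\alpha_0)$. A function $f\colon X\to\overline{\mathbb{R}}$ with $f(0)=0$ is superhomogeneous if $f(\alpha\Delta x)\ge\alpha f(\Delta x)$ for all $\Delta x\in X$, $\alpha\in(0,1)$. $\overline{\partial}_Hg(0)=\{h\in H\mid h\ge g \text{ on } X,\ h(0)=g(0)\}$ is the $H$-superdifferential of $g$ at $0$; $0\in\overline{\partial}_Hg(0)$ refers to the zero function. *)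

(* Defs.v *)
From HB Require Import structures.
From mathcomp Require Import all_boot all_order all_algebra.
From mathcomp Require Import all_classical all_reals all_analysis.
From mathcomp Require Import complex.

Set Implicit Arguments.
Unset Strict Implicit.
Unset Printing Implicit Defensive.

Import Order.TTheory GRing.Theory Num.Theory.
Import numFieldNormedType.Exports.

Local Open Scope classical_set_scope.
Local Open Scope ring_scope.

Variant scalar_kind := RealScalars | ComplexScalars.

Definition scalar_field (R : realType) (k : scalar_kind) : numFieldType :=
  match k with
  | RealScalars => R
  | ComplexScalars => R[i]
  end.

Definition of_real (R : realType) (k : scalar_kind) : R -> scalar_field R k :=
  match k with
  | RealScalars => fun a => a
  | ComplexScalars => fun a => (a%:C)%C
  end.
Arguments of_real {R} k a.

(* Over [R[i]], the weights [{i01 R[i]}] of [convex_set] are exactly the real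
   numbers of [0, 1], as the order of [R[i]] only compares complex numbers with
   equal imaginary parts: convexity is the usual real one for both kinds of
   scalars. *)
Definition co (R : realType) (k : scalar_kind)
    (X : topologicalLmodType (scalar_field R k)) (A : set X) : set X :=
  smallest (@convex_set (scalar_field R k) X) A.

Definition edom (R : realType) (X : Type) (f : X -> \bar R) : set X :=
  [set x | f x \is a fin_num].

Definition shift_closed (R : realType) (X : Type) (H : set (X -> \bar R)) :=
  forall (h : X -> \bar R) (c : R), H h -> H (fun x => (h x + c%:E)%E).

Definition H_concave (R : realType) (X : Type) (H : set (X -> \bar R))
    (psi : X -> \bar R) :=
  exists S : set (X -> \bar R),
    [/\ S `<=` H, S !=set0 & forall x, psi x = ereal_inf [set h x | h in S]].

(* Only the values of [beta] on ]0, alpha0[ are constrained. *)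
Definition weak_lower_H_concave_approx (R : realType) (k : scalar_kind)
    (X : topologicalLmodType (scalar_field R k)) (H : set (X -> \bar R))
    (f : X -> R) (x : X) (psi : X -> \bar R) :=
  [/\ H_concave H psi,
      (psi 0%R <= 0)%E,
      (edom psi)° 0
    & forall dx : X, exists (alpha0 : R) (beta : R -> R),
      [/\ 0 < alpha0,
          co [set 0; of_real k alpha0 *: dx] `<=` edom psi,
          beta a @[a --> 0^'+] --> 0
        & forall a : R, 0 < a < alpha0 ->
          (psi (of_real k a *: dx)%R - (a * beta a)%R%:E
             <= (f (x + of_real k a *: dx) - f x)%R%:E)%E]].

Definition superhomogeneous (R : realType) (k : scalar_kind)
    (X : topologicalLmodType (scalar_field R k)) (f : X -> \bar R) :=
  f 0 = 0%E /\
  forall (dx : X) (a : R), 0 < a < 1 ->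
    (a%:E * f dx <= f (of_real k a *: dx)%R)%E.

Definition superdifferential0 (R : realType) (k : scalar_kind)
    (X : topologicalLmodType (scalar_field R k)) (H : set (X -> \bar R))
    (g : X -> \bar R) : set (X -> \bar R) :=
  [set h | [/\ H h, forall x, (g x <= h x)%E & h 0 = g 0]].

(* Index [ord0] is the objective and the indices [lift ord0 i], [i : 'I_n],
   are the [n] inequality constraints. *)
Definition feasible (R : realType) (X : Type) (n : nat) (A : set X)
    (f : 'I_n.+1 -> X -> R) : set X :=
  [set x | A x /\ forall i : 'I_n, 0 <= f (lift ord0 i) x].

Definition local_max (R : realType) (X : topologicalType) (D : set X)
    (f : X -> R) (x0 : X) :=
  D x0 /\ \forall x \near x0, D x -> f x <= f x0.

Definition global_max (R : realType) (X : Type) (D : set X)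
    (f : X -> \bar R) (x0 : X) :=
  D x0 /\ forall x, D x -> (f x <= f x0)%E.

Definition inf_approx (R : realType) (X : Type) (n : nat)
    (f : 'I_n.+1 -> X -> R) (psi : 'I_n.+1 -> X -> \bar R) (xs : X) :
    X -> \bar R :=
  fun dx => ereal_inf (psi ord0 dx |`
    [set (psi (lift ord0 i) dx + (f (lift ord0 i) xs)%:E)%E | i in [set: 'I_n]]).

(* Main.v *)
Require Import Defs.
From HB Require Import structures.
From mathcomp Require Import all_boot all_order all_algebra.
From mathcomp Require Import all_classical all_reals all_analysis.
From mathcomp Require Import complex lra.

Set Implicit Arguments.
Unset Strict Implicit.
Unset Printing Implicit Defensive.

Import Order.TTheory GRing.Theory Num.Theory.
Import numFieldNormedType.Exports.

Local Open Scope classical_set_scope.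
Local Open Scope ring_scope.

(** If [g (y - xs) > 0] for some [y] in [A], choose a real [r > 0] with
    [r <= g (y - xs)]: [g] may take the value [+oo].  By superhomogeneity
    [g (a (y - xs)) >= a r] for [0 < a < 1], so every [psi i] grows at least
    linearly along the segment from [xs] to [y], beating the error [a * beta a].
    Hence for all small [a > 0] the point [xs + a (y - xs)] is feasible and
    strictly better than [xs], contradicting local optimality. *)

Lemma of_real1 (R : realType) (k : scalar_kind) : of_real k (1 : R) = 1.
Proof. by case: k. Qed.

Lemma of_real0 (R : realType) (k : scalar_kind) : of_real k (0 : R) = 0.
Proof. by case: k. Qed.

Lemma ler_of_real (R : realType) (k : scalar_kind) (a b : R) :
  (of_real k a <= of_real k b) = (a <= b).
Proof. by case: k => //=; rewrite lecR. Qed.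

Lemma ltr_of_real (R : realType) (k : scalar_kind) (a b : R) :
  (of_real k a < of_real k b) = (a < b).
Proof. by case: k => //=; rewrite ltcR. Qed.

(** The order of [R[i]] compares only numbers with equal imaginary parts, so [0 < e] forces [e] to
    be real. Epsilons in either scalar field thus reduce to real ones. *)
Lemma of_real_surj_gt0 (R : realType) (k : scalar_kind) (e : scalar_field R k) :
  0 < e -> exists2 d : R, 0 < d & of_real k d = e.
Proof.
case: k e => /= e e_gt0; first by exists e.
case: e e_gt0 => a b; rewrite ltcE /= => /andP[/eqP -> a_gt0].
by exists a.
Qed.

Lemma cvg_of_real_at_right0 (R : realType) (k : scalar_kind) :
  of_real k a @[a --> (0 : R)^'+] --> (0 : (scalar_field R k)^o).
Proof.
apply/cvgr0Pnorm_lt => e e_gt0.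
have [d d_gt0 <-] := of_real_surj_gt0 e_gt0.
near=> a.
have a_gt0 : 0 < a by [].
rewrite ger0_norm ?ltr_of_real; first by near: a; exact: nbhs_right_lt.
by rewrite -(of_real0 R k) ler_of_real ltW.
Unshelve. all: by end_near. Qed.

(** Joint continuity of scaling at [(0, v)] and of addition at [(x, 0)]. This pulls neighbourhoods
    of [x] back to small steps [a] along a segment. *)
Lemma cvg_ray_at_right0 (R : realType) (k : scalar_kind)
    (X : topologicalLmodType (scalar_field R k)) (x v : X) :
  x + of_real k a *: v @[a --> (0 : R)^'+] --> x.
Proof.
have cvg_scale : of_real k a *: v @[a --> (0 : R)^'+] --> (0 : X).
  rewrite -[X in _ --> X](scale0r v).
  exact: (cvg_comp2 (cvg_of_real_at_right0 (k := k)) (cvg_cst v)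
    (@scale_continuous _ _ (0, v))).
rewrite -[X in _ --> X]addr0.
exact: (cvg_comp2 (cvg_cst x) cvg_scale (@add_continuous _ (x, 0))).
Qed.

Lemma convex_set_ray (R : realType) (k : scalar_kind)
    (X : topologicalLmodType (scalar_field R k)) (A : set X) (x y : X) (a : R) :
  @convex_set (scalar_field R k) X A -> A x -> A y -> 0 <= a <= 1 ->
  A (x + of_real k a *: (y - x)).
Proof.
move=> convA Ax Ay /andP[a_ge0 a_le1].
have ka_ge0 : 0 <= of_real k a by rewrite -(of_real0 R k) ler_of_real.
have ka_le1 : of_real k a <= 1 by rewrite -(of_real1 R k) ler_of_real.
(* The weight [a] falls on the first point, hence [y] before [x]. *)
have := convA y x (Itv01 ka_ge0 ka_le1) (mem_set Ay) (mem_set Ax).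
move=> /set_mem; congr A.
rewrite /conv /= scalerBl scale1r scalerBr.
by rewrite addrCA addrA.
Qed.

(** Once [b a < r], the increment of [f] is at least [a * r - c - a * b a], which exceeds [- c]. The
    shift [c] lets one statement serve the objective ([c = 0]) and the constraints ([c] the value at
    [x]). *)
Lemma approx_gt (R : realType) (k : scalar_kind)
    (X : topologicalLmodType (scalar_field R k)) (H : set (X -> \bar R))
    (f : X -> R) (x : X) (psi : X -> \bar R) (v : X) (c r : R) :
  weak_lower_H_concave_approx H f x psi -> 0 < r ->
  (forall a : R, 0 < a < 1 -> ((a * r)%:E <= psi (of_real k a *: v)%R + c%:E)%E) ->
  \forall a \near (0 : R)^'+, f x - c < f (x + of_real k a *: v).
Proof.
move=> [_ _ _ /(_ v)[a0 [b [a0_gt0 _ b_cvg0 f_ge]]]] r_gt0 psi_ge.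
near=> a.
have a_gt0 : 0 < a by [].
have a_lt1 : a < 1 by near: a; exact: nbhs_right_lt.
have a_lt0 : a < a0 by near: a; exact: nbhs_right_lt.
have b_ltr : b a < r by near: a; exact: (cvgr_lt (0 : R)).
have := f_ge a; rewrite a_gt0 a_lt0 => /(_ isT).
have := psi_ge a; rewrite a_gt0 a_lt1 => /(_ isT).
(* The upper bound by a real increment of [f] excludes [+oo], and the lower bound [a * r] excludes
   [-oo]. *)
case: (psi _) => [s| |] //=.
rewrite -EFinD -EFinB !lee_fin => le_rs le_sf.
have : a * b a < a * r by rewrite ltr_pM2l.
lra.
Unshelve. all: by end_near. Qed.

Lemma inf_approx_le_obj (R : realType) (X : Type) (n : nat)
    (f : 'I_n.+1 -> X -> R) (psi : 'I_n.+1 -> X -> \bar R) (xs v : X) :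
  (inf_approx f psi xs v <= psi ord0 v)%E.
Proof. by apply: ereal_inf_lbound; left. Qed.

Lemma inf_approx_le_constr (R : realType) (X : Type) (n : nat)
    (f : 'I_n.+1 -> X -> R) (psi : 'I_n.+1 -> X -> \bar R) (xs v : X) (i : 'I_n) :
  (inf_approx f psi xs v <= psi (lift ord0 i) v + (f (lift ord0 i) xs)%:E)%E.
Proof. by apply: ereal_inf_lbound; right; exists i. Qed.

Lemma ereal_gt0_real_below (R : realType) (y : \bar R) :
  (0 < y)%E -> exists2 r : R, 0 < r & (r%:E <= y)%E.
Proof.
case: y => [s| |] //= y_gt0; last by exists 1; rewrite ?leey.
by exists s.
Qed.

Theorem theorem5p3 (R : realType) (k : scalar_kind)
    (X : topologicalLmodType (scalar_field R k)) (hausX : hausdorff_space X)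
    (A : set X) (convA : @convex_set (scalar_field R k) X A)
    (H : set (X -> \bar R)) (H_neq0 : H !=set0) (shiftH : shift_closed H)
    (n : nat) (f : 'I_n.+1 -> X -> R) (psi : 'I_n.+1 -> X -> \bar R)
    (xs : X) (Axs : A xs)
    (psiP : forall i, weak_lower_H_concave_approx H (f i) xs (psi i))
    (psi0 : forall i, psi i 0 = 0%E)
    (xs_max : local_max (feasible A f) (f ord0) xs)
    (g_superhom : superhomogeneous (inf_approx f psi xs)) :
  global_max [set a - xs | a in A] (inf_approx f psi xs) 0 /\
  (A = [set: X] -> H (fun=> 0%E) ->
   superdifferential0 H (inf_approx f psi xs) (fun=> 0%E)).
Proof.
set g := inf_approx f psi xs in g_superhom *.
have [g0 g_sh] := g_superhom.
have g_le0 : forall y, A y -> (g (y - xs)%R <= 0)%E.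
  move=> y Ay; rewrite leNgt; apply/negP => /ereal_gt0_real_below[r r_gt0 le_rg].
  have g_ge (a : R) : 0 < a < 1 ->
      ((a * r)%:E <= g (of_real k a *: (y - xs))%R)%E.
    move=> a01; apply: le_trans (g_sh _ _ a01).
    by case/andP: a01 => a_gt0 _; rewrite EFinM lee_pmul2l.
  have obj_gt : \forall a \near (0 : R)^'+,
      f ord0 xs - 0 < f ord0 (xs + of_real k a *: (y - xs)).
    apply: (approx_gt (psiP ord0) r_gt0) => a /g_ge /le_trans; apply.
    by rewrite adde0; exact: inf_approx_le_obj.
  (* The left side is zero, so every constraint, active or not, becomes strictly positive;
     finiteness of ['I_n] gives one common range of [a]. *)
  have constr_gt : \forall a \near (0 : R)^'+, forall i : 'I_n,
      f (lift ord0 i) xs - f (lift ord0 i) xs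
      < f (lift ord0 i) (xs + of_real k a *: (y - xs)).
    apply: filter_forall => i.
    apply: (approx_gt (psiP _) r_gt0) => a /g_ge /le_trans; apply.
    exact: inf_approx_le_constr.
  have [_ xs_opt] := xs_max.
  have ray_opt := cvg_ray_at_right0 (y - xs) xs_opt.
  (* The filter [0^'+] is proper, so no contradiction can hold eventually. *)
  suff : \forall a \near (0 : R)^'+, False by case/filter_ex.
  near=> a.
  have a_gt0 : 0 < a by [].
  have a_lt1 : a < 1 by near: a; exact: nbhs_right_lt.
  have xa_feasible : feasible A f (xs + of_real k a *: (y - xs)).
    split; first by apply: convex_set_ray => //; rewrite !ltW.
    move=> i; rewrite -[leLHS](subrr (f (lift ord0 i) xs)) ltW//.
    by move: i; near: a.
  have le_obj : f ord0 (xs + of_real k a *: (y - xs)) <= f ord0 xs.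
    by move: xa_feasible; near: a.
  have : f ord0 xs - 0 < f ord0 (xs + of_real k a *: (y - xs)) by near: a.
  by rewrite subr0 ltNge le_obj.
split; first split.
- by exists xs => //; rewrite subrr.
- by move=> _ [y Ay <-]; rewrite g0 g_le0.
move=> AT H0; split => // x.
(* Every [x] is [(x + xs) - xs], so the bound on [A - xs] covers all of [X]. *)
by rewrite -[x](addrK xs) g_le0// AT.
Unshelve. all: by end_near. Qed.
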